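(* For every integer $k\geqslant 1$, $$\zeta^{2}(2k)+\zeta(4k)=\sum_{n=1}^{+\infty}\frac{a_{k}(n)}{n^{4k-1}}.$$
   Context: $\zeta$ denotes the Riemann zeta function. For integers $k\geqslant 1$ and $r\geqslant 0$ put $\varepsilon_{r}=\varepsilon_{r}(k)=\exp\bigl(\frac{2\pi i(r+1/2)}{2k}\bigr)$. For real $w>0$ define $a_{k}(w)=\frac{1}{k}\sum_{r=0}^{k-1}\pi\varepsilon_{r}\cot(\pi\varepsilon_{r}w)$. *)

(* Defs.v *)
From Stdlib Require Import Reals.
From Coquelicot Require Import Coquelicot.
Open Scope C_scope.

Definition Cexp (z : C) : C :=
  RtoC (exp (Re z)) * (RtoC (cos (Im z)) + Ci * RtoC (sin (Im z))).

Definition Ccos (z : C) : C := (Cexp (Ci * z) + Cexp (- (Ci * z))) / 2.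

Definition Csin (z : C) : C := (Cexp (Ci * z) - Cexp (- (Ci * z))) / (2 * Ci).

Definition Ccot (z : C) : C := Ccos z / Csin z.

(* [Series] is only available for real sequences; this is the sum of [u]
   whenever [u] is summable in [C]. *)
Definition CSeries (u : nat -> C) : C :=
  (Series (fun n => Re (u n)), Series (fun n => Im (u n))).

(* Given by its Dirichlet series, hence meaningful only for [1 < Re s]; no
   analytic continuation is encoded. The summation index is shifted by one,
   and m^(-s) is exp (- s ln m). *)
Definition zeta (s : C) : C :=
  CSeries (fun n => Cexp (- (s * RtoC (ln (INR (S n)))))).

Definition eps (k r : nat) : C :=
  Cexp (2 * RtoC PI * Ci * (RtoC (INR r) + 1 / 2) / (2 * RtoC (INR k))).

(* [sum_n u N] includes the term [u N], so for [1 <= k] the index [r] runs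
   from 0 to k - 1; [k = 0] is not meaningful. *)
Definition a (k : nat) (w : R) : C :=
  / RtoC (INR k) *
  sum_n (fun r : nat =>
           RtoC PI * eps k r * Ccot (RtoC PI * eps k r * RtoC w)) (k - 1).

(* Main.v *)
Require Import Defs.
From Stdlib Require Import Reals.
From Coquelicot Require Import Coquelicot.
From Stdlib Require Import Lia Lra.
Open Scope C_scope.

(**
The cotangent has the expansion [PI cot (PI z) = 1 / z + sum_j 2 z / (z^2 - j^2)]
([Ccot_partial_fractions]). Put [z = eps k r * n], multiply by [eps k r] and
average over [r]. The squares of the [eps k r] run through the k-th roots of -1,
so the terms with a given [j] collapse to a single real fraction
([average_over_eps]), and

    [a k n = 1 / n + 2 n^(2k-1) * sum_j 1 / (n^(2k) + j^(2k))]

([a_eq_Series]). Dividing by [n^(4k-1)] and writing [A n = n^(2k)], the series of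
the theorem becomes

    [sum_n 1 / n^(4k) + sum_n sum_j 2 / (A n * (A n + A j))].

The first sum is [zeta (4k)]. In the second, exchanging [n] and [j] and adding
turns the general term into [2 / (A n * A j)], so it equals the square of
[sum_n 1 / A n = zeta (2k)] ([is_series_symmetrized]).

The cotangent expansion itself is obtained without complex analysis. The finite
identity [N cot (N u) = sum_(j < N) cot (u + j PI / N)] ([Ccot_mult]) is the
statement that a sum over N-th roots of unity retains only the powers divisible
by [N] ([sum_inv_unity_roots]); the same lemma gives the average over [r].
Pairing [j] with [N - j] ([Ccot_pairs]) makes the terms quadratically small, and
letting [N] tend to infinity under the sum sign is an instance of Tannery's
theorem ([tannery]). *)

(** * Finite sums of complex numbers *)

(** The type of a [sum_n] is a projection of an algebraic structure; [ring] and
[field] need the equation to be stated at the type itself. *)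
Ltac eq_in T := lazymatch goal with |- @eq _ ?x ?y => change (@eq T x y) end.
Ltac Cring := eq_in C; ring.
Ltac Cfield := eq_in C; field.
Ltac Rring := eq_in R; ring.
Ltac Rfield := eq_in R; field.

Lemma Csum_Sn (f : nat -> C) (n : nat) : sum_n f (S n) = sum_n f n + f (S n).
Proof. exact (sum_Sn f n). Qed.

Lemma Csum_head (f : nat -> C) (n : nat) :
  sum_n f (S n) = f 0%nat + sum_n (fun i => f (S i)) n.
Proof.
  induction n as [|n IH].
  - now rewrite Csum_Sn, !sum_O.
  - rewrite Csum_Sn, IH, (Csum_Sn (fun i => f (S i))). Cring.
Qed.

Lemma Csum_mult_l (c : C) (f : nat -> C) (n : nat) :
  sum_n (fun j => c * f j) n = c * sum_n f n.
Proof. exact (sum_n_mult_l (K := C_Ring) c f n). Qed.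

Lemma Csum_plus (f g : nat -> C) (n : nat) :
  sum_n (fun j => f j + g j) n = sum_n f n + sum_n g n.
Proof. exact (sum_n_plus f g n). Qed.

Lemma Csum_const (c : C) (n : nat) : sum_n (fun _ => c) n = RtoC (INR (S n)) * c.
Proof.
  induction n as [|n IH].
  - rewrite sum_O. simpl. ring.
  - rewrite Csum_Sn, IH, (S_INR (S n)), RtoC_plus. Cring.
Qed.

Lemma Csum_first (f : nat -> C) (n : nat) :
  (forall j, (0 < j <= n)%nat -> f j = RtoC 0) -> sum_n f n = f 0%nat.
Proof.
  induction n as [|n IH]; intros H.
  - apply sum_O.
  - rewrite Csum_Sn, IH, (H (S n)) by (try lia; intros; apply H; lia). Cring.
Qed.

Lemma sum_fold_pairs (f : nat -> C) (m : nat) :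
  sum_n f (2 * m + 1) = sum_n (fun i => f i + f (2 * m + 1 - i)%nat) m.
Proof.
  revert f. induction m as [|m IH]; intros f.
  - simpl. now rewrite Csum_Sn, !sum_O.
  - replace (2 * S m + 1)%nat with (S (S (2 * m + 1))) by lia.
    rewrite Csum_Sn, Csum_head, IH, Csum_head.
    rewrite (sum_n_ext_loc (fun i => f (S i) + f (S (S (2 * m + 1)) - S i)%nat)
      (fun i => f (S i) + f (S (2 * m + 1 - i)))).
    + replace (S (S (2 * m + 1)) - 0)%nat with (S (S (2 * m + 1))) by lia. Cring.
    + intros i Hi. do 2 f_equal. lia.
Qed.

Lemma Csum_RtoC (f : nat -> R) (n : nat) :
  sum_n (fun j => RtoC (f j)) n = RtoC (sum_n f n).
Proof.
  induction n as [|n IH].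
  - now rewrite !sum_O.
  - rewrite Csum_Sn, IH, <- RtoC_plus. now rewrite sum_Sn.
Qed.

Lemma Re_Csum (f : nat -> C) (n : nat) :
  Re (sum_n f n) = sum_n (fun j => Re (f j)) n.
Proof.
  induction n as [|n IH].
  - now rewrite !sum_O.
  - now rewrite Csum_Sn, sum_Sn, <- IH.
Qed.

Lemma Im_Csum (f : nat -> C) (n : nat) :
  Im (sum_n f n) = sum_n (fun j => Im (f j)) n.
Proof.
  induction n as [|n IH].
  - now rewrite !sum_O.
  - now rewrite Csum_Sn, sum_Sn, <- IH.
Qed.

(** * The complex exponential and roots of unity *)

Lemma Cexp_pair (x y : R) : Cexp (x, y) = ((exp x * cos y)%R, (exp x * sin y)%R).
Proof. unfold Cexp, Ci, RtoC, Cmult, Cplus; simpl. f_equal; ring. Qed.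

Lemma Cexp_plus (z w : C) : Cexp (z + w) = Cexp z * Cexp w.
Proof.
  destruct z as [x y], w as [x' y'].
  unfold Cplus; simpl. rewrite !Cexp_pair, exp_plus, cos_plus, sin_plus.
  unfold Cmult; simpl. f_equal; ring.
Qed.

Lemma Cexp_0 : Cexp 0 = 1.
Proof. unfold RtoC at 1. rewrite Cexp_pair, exp_0, cos_0, sin_0. unfold RtoC; f_equal; ring. Qed.

Lemma Cexp_neq_0 (z : C) : Cexp z <> 0.
Proof.
  intros H. apply C1_nz. rewrite <- Cexp_0, <- (Cplus_opp_r z), Cexp_plus, H. ring.
Qed.

Lemma Cexp_opp (z : C) : Cexp (- z) = / Cexp z.
Proof.
  assert (Hz := Cexp_neq_0 z).
  assert (H : Cexp z * Cexp (- z) = 1) by now rewrite <- Cexp_plus, Cplus_opp_r, Cexp_0.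
  replace (Cexp (- z)) with (/ Cexp z * (Cexp z * Cexp (- z))) by (field; exact Hz).
  rewrite H. ring.
Qed.

Lemma Cexp_pow (z : C) (n : nat) : Cexp z ^ n = Cexp (RtoC (INR n) * z).
Proof.
  induction n as [|n IH].
  - simpl. now rewrite Cmult_0_l, Cexp_0.
  - rewrite Cpow_S, IH, S_INR, RtoC_plus, <- Cexp_plus. f_equal. ring.
Qed.

Lemma Cexp_Im (t : R) : Cexp (Ci * RtoC t) = (cos t, sin t).
Proof.
  replace (Ci * RtoC t) with (0%R, t) by (unfold Ci, RtoC, Cmult; simpl; f_equal; ring).
  rewrite Cexp_pair, exp_0. f_equal; ring.
Qed.

Lemma Cexp_Im_neq_1 (t : R) : (0 < t < 2 * PI)%R -> Cexp (Ci * RtoC t) <> 1.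
Proof.
  intros Ht H. rewrite Cexp_Im in H. injection H as H _.
  assert (Hs : (0 < sin (t / 2))%R) by (apply sin_gt_0; lra).
  replace t with (2 * (t / 2))%R in H by field.
  rewrite cos_2a_sin in H. nra.
Qed.

Definition unity_root (n : nat) : C := Cexp (Ci * RtoC (2 * PI / INR n)).

Lemma unity_root_pow (n : nat) : (0 < n)%nat -> unity_root n ^ n = 1.
Proof.
  intros Hn. unfold unity_root. rewrite Cexp_pow.
  assert (INR n <> 0%R) by (apply not_0_INR; lia).
  replace (RtoC (INR n) * (Ci * RtoC (2 * PI / INR n))) with (Ci * RtoC (2 * PI)).
  - now rewrite Cexp_Im, cos_2PI, sin_2PI.
  - replace (2 * PI)%R with (INR n * (2 * PI / INR n))%R at 1 by now field.
    rewrite RtoC_mult. ring.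
Qed.

Lemma unity_root_pow_neq_1 (n i : nat) : (0 < i < n)%nat -> unity_root n ^ i <> 1.
Proof.
  intros Hi. unfold unity_root. rewrite Cexp_pow.
  assert (0 < INR n)%R by (apply lt_0_INR; lia).
  assert (0 < INR i)%R by (apply lt_0_INR; lia).
  assert (INR i < INR n)%R by (apply lt_INR; lia).
  assert (0 < PI)%R by apply PI_RGT_0.
  replace (RtoC (INR i) * (Ci * RtoC (2 * PI / INR n)))
    with (Ci * RtoC (2 * PI * (INR i / INR n))).
  - apply Cexp_Im_neq_1.
    assert (0 < INR i / INR n)%R by now apply Rdiv_lt_0_compat.
    assert (INR i / INR n < 1)%R by (apply Rlt_div_l; lra).
    split; nra.
  - replace (2 * PI * (INR i / INR n))%R with (INR i * (2 * PI / INR n))%R by (field; lra).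
    rewrite RtoC_mult. ring.
Qed.

Lemma pow_diff_factor (t y : C) (n : nat) :
  (y - t) * sum_n (fun i => t ^ i * y ^ (n - i)) n = y ^ S n - t ^ S n.
Proof.
  induction n as [|n IH].
  - rewrite sum_O. simpl. ring.
  - rewrite Csum_Sn, Nat.sub_diag.
    rewrite (sum_n_ext_loc _ (fun i => y * (t ^ i * y ^ (n - i)))).
    + rewrite Csum_mult_l, Cmult_plus_distr_l.
      replace ((y - t) * (y * sum_n (fun i => t ^ i * y ^ (n - i)) n))
        with (y * ((y - t) * sum_n (fun i => t ^ i * y ^ (n - i)) n)) by ring.
      rewrite IH. simpl. ring.
    + intros i Hi. replace (S n - i)%nat with (S (n - i)) by lia. simpl. ring.
Qed.

(** The power sum is geometric with ratio [z = unity_root (S n) ^ i], and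
[z ^ (S n) = 1] while [z <> 1]. *)
Lemma unity_root_power_sum (n i : nat) :
  (0 < i <= n)%nat -> sum_n (fun r => (unity_root (S n) ^ i) ^ r) n = RtoC 0.
Proof.
  intros Hi.
  set (z := unity_root (S n) ^ i).
  assert (Hz : z <> 1) by (apply unity_root_pow_neq_1; lia).
  assert (HN : z ^ S n = 1).
  { unfold z. rewrite <- Cpow_mult_r, Nat.mul_comm, Cpow_mult_r, unity_root_pow by lia.
    apply Cpow_1_l. }
  assert (H := pow_diff_factor z 1 n). rewrite HN, Cpow_1_l in H.
  rewrite (sum_n_ext _ (fun r => z ^ r)) in H by (intros r; rewrite Cpow_1_l; Cring).
  assert (H1 : 1 - z <> 0) by (intros E; apply Hz; replace z with (1 - (1 - z)) by ring; rewrite E; ring).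
  replace (sum_n (fun r => z ^ r) n) with (/ (1 - z) * ((1 - z) * sum_n (fun r => z ^ r) n))
    by (field; exact H1).
  rewrite H. Cring.
Qed.

(** All the poles [t = q * unity_root (S n) ^ r] share the value [t ^ (S n) =
q ^ (S n)], so [/ (y - t)] is the sum of the [t ^ i * y ^ (n - i)] over one
common denominator; summing over [r] kills every power [i > 0]. The cotangent
expansion uses it with [y = 1], the average defining [a] with [y] a square. *)
Lemma sum_inv_unity_roots (n : nat) (q y : C) :
  y ^ S n <> q ^ S n ->
  sum_n (fun r => / (y - q * unity_root (S n) ^ r)) n
  = RtoC (INR (S n)) * y ^ n / (y ^ S n - q ^ S n).
Proof.
  intros Hne.
  set (z := unity_root (S n)).
  assert (Hd : y ^ S n - q ^ S n <> 0).
  { intros E. apply Hne. replace (y ^ S n) with (y ^ S n - q ^ S n + q ^ S n) by ring.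
    rewrite E. ring. }
  rewrite (sum_n_ext _ (fun r => sum_n (fun i =>
      / (y ^ S n - q ^ S n) * q ^ i * y ^ (n - i) * (z ^ i) ^ r) n)).
  - rewrite sum_n_switch.
    rewrite Csum_first.
    + rewrite (sum_n_ext _ (fun _ => y ^ n / (y ^ S n - q ^ S n))).
      * rewrite Csum_const. unfold Cdiv. Cring.
      * intros r. replace (z ^ 0) with (RtoC 1) by reflexivity.
        rewrite Cpow_1_l, Nat.sub_0_r. simpl (q ^ 0). unfold Cdiv. Cring.
    + intros i Hi. rewrite Csum_mult_l. unfold z. rewrite unity_root_power_sum by lia. ring.
  - intros r.
    assert (Ht : (q * z ^ r) ^ S n = q ^ S n).
    { rewrite Cpow_mult_l, <- (Cpow_mult_r z), Nat.mul_comm, Cpow_mult_r.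
      unfold z. rewrite unity_root_pow, Cpow_1_l by lia. ring. }
    assert (H := pow_diff_factor (q * z ^ r) y n). rewrite Ht in H.
    rewrite (sum_n_ext _ (fun i => / (y ^ S n - q ^ S n) * ((q * z ^ r) ^ i * y ^ (n - i)))).
    + rewrite Csum_mult_l, <- H. Cfield. split.
      * intros E. apply Hd. rewrite <- H, E. ring.
      * intros E. apply Hd. rewrite <- H, E. ring.
    + intros i. rewrite Cpow_mult_l, <- !Cpow_mult_r, (Nat.mul_comm i r). Cring.
Qed.

(** * Complex trigonometric functions and a finite cotangent expansion *)

Lemma Csin_pair (x y : R) : Csin (x, y) = ((sin x * cosh y)%R, (cos x * sinh y)%R).
Proof.
  unfold Csin.
  replace (Ci * (x, y)) with ((- y)%R, x) by (unfold Ci, Cmult; simpl; f_equal; ring).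
  replace (- ((- y)%R, x)) with (y, (- x)%R) by (unfold Copp; simpl; f_equal; ring).
  rewrite !Cexp_pair, cos_neg, sin_neg.
  unfold cosh, sinh, Cdiv, Cminus, Cinv, Cmult, Cplus, Copp, Ci, RtoC; simpl.
  f_equal; field.
Qed.

Lemma Ccos_pair (x y : R) : Ccos (x, y) = ((cos x * cosh y)%R, (- (sin x * sinh y))%R).
Proof.
  unfold Ccos.
  replace (Ci * (x, y)) with ((- y)%R, x) by (unfold Ci, Cmult; simpl; f_equal; ring).
  replace (- ((- y)%R, x)) with (y, (- x)%R) by (unfold Copp; simpl; f_equal; ring).
  rewrite !Cexp_pair, cos_neg, sin_neg.
  unfold cosh, sinh, Cdiv, Cminus, Cinv, Cmult, Cplus, Copp, Ci, RtoC; simpl.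
  f_equal; field.
Qed.

Lemma Csin_R (t : R) : Csin t = sin t.
Proof.
  unfold RtoC at 1. rewrite Csin_pair, cosh_0, sinh_0. unfold RtoC. f_equal; ring.
Qed.

Lemma Csin_plus (z w : C) : Csin (z + w) = Csin z * Ccos w + Ccos z * Csin w.
Proof.
  unfold Csin, Ccos. rewrite Cmult_plus_distr_l.
  replace (- (Ci * z + Ci * w)) with (- (Ci * z) + - (Ci * w)) by ring.
  rewrite !Cexp_plus. field. repeat split; try exact Ci_nz; injection; lra.
Qed.

Lemma Csin_opp (z : C) : Csin (- z) = - Csin z.
Proof.
  unfold Csin. replace (Ci * - z) with (- (Ci * z)) by ring.
  replace (- - (Ci * z)) with (Ci * z) by ring. field. repeat split; try exact Ci_nz; injection; lra.
Qed.

Lemma Ccos_opp (z : C) : Ccos (- z) = Ccos z.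
Proof.
  unfold Ccos. replace (Ci * - z) with (- (Ci * z)) by ring.
  replace (- - (Ci * z)) with (Ci * z) by ring. field.
Qed.

Lemma Csin2_Ccos2 (z : C) : Csin z * Csin z + Ccos z * Ccos z = 1.
Proof.
  unfold Csin, Ccos. rewrite !Cexp_opp. assert (H := Cexp_neq_0 (Ci * z)).
  set (X := Cexp (Ci * z)) in *.
  (* [field] sees Ci as an indeterminate: its square has to be isolated first. *)
  replace ((X - / X) / (2 * Ci) * ((X - / X) / (2 * Ci))) with
    ((X - / X) * (X - / X) / (4 * (Ci * Ci))).
  - replace (Ci * Ci) with (RtoC (-1)) by (unfold Ci, RtoC, Cmult; simpl; f_equal; ring).
    field. repeat split; try exact H; injection; lra.
  - field. repeat split; try exact H; try exact Ci_nz; injection; lra.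
Qed.

Lemma Csin_mult_plus_minus (u v : C) :
  Csin (u + v) * Csin (u - v) = Csin u ^ 2 - Csin v ^ 2.
Proof.
  unfold Cminus at 1. rewrite !Csin_plus, Csin_opp, Ccos_opp.
  assert (Hu := Csin2_Ccos2 u). assert (Hv := Csin2_Ccos2 v).
  replace ((Csin u * Ccos v + Ccos u * Csin v) * (Csin u * Ccos v + Ccos u * - Csin v))
    with (Csin u ^ 2 * (Csin v * Csin v + Ccos v * Ccos v)
          - (Csin u * Csin u + Ccos u * Ccos u) * Csin v ^ 2) by ring.
  rewrite Hu, Hv. ring.
Qed.

(** On a non-real point [sinh (Im z)] and [cosh (Im z)] do not vanish, and [sin]
and [cos] have no common real zero. *)
Lemma Csin_neq_0 (z : C) : Im z <> 0%R -> Csin z <> 0.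
Proof.
  destruct z as [x y]; simpl. intros Hy H. rewrite Csin_pair in H.
  injection H as H1 H2.
  assert (Hc : (0 < cosh y)%R).
  { unfold cosh. assert (H := exp_pos y). assert (H' := exp_pos (- y)). lra. }
  assert (Hs : sinh y <> 0%R).
  { intros E. apply Hy. rewrite <- (arcsinh_sinh y), E.
    transitivity (arcsinh (sinh 0)); [now rewrite sinh_0 | apply arcsinh_sinh]. }
  assert (sin x = 0)%R by (apply Rmult_integral in H1; lra).
  assert (cos x = 0)%R by (apply Rmult_integral in H2; tauto).
  assert (E := sin2_cos2 x). unfold Rsqr in E. nra.
Qed.

Lemma Ccot_plus_minus (u v : C) :
  Csin (u + v) <> 0 -> Csin (u - v) <> 0 ->
  Ccot (u + v) + Ccot (u - v) = Csin (2 * u) / (Csin u ^ 2 - Csin v ^ 2).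
Proof.
  intros Hp Hm.
  rewrite <- Csin_mult_plus_minus. replace (2 * u) with ((u + v) + (u - v)) by ring.
  rewrite (Csin_plus (u + v)). unfold Ccot. field. now split.
Qed.

(** With [q = exp (2 i z)], [cot z] is a Moebius transform of [q]; translating [z] by
[PI / N] multiplies [q] by an N-th root of unity, which is how
[sum_inv_unity_roots] enters. *)
Lemma Ccot_Cexp (z : C) :
  Csin z <> 0 -> Cexp (Ci * z) ^ 2 <> 1 /\
  Ccot z = Ci * (1 - 2 * / (1 - Cexp (Ci * z) ^ 2)).
Proof.
  intros Hs. assert (H := Cexp_neq_0 (Ci * z)).
  unfold Ccot, Ccos, Csin in *. rewrite Cexp_opp in *.
  set (X := Cexp (Ci * z)) in *.
  assert (HX : X ^ 2 <> 1).
  { intros E. apply Hs.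
    replace ((X - / X) / (2 * Ci)) with ((X ^ 2 - 1) / (2 * Ci * X)).
    - rewrite E. field. repeat split; try exact H; try exact Ci_nz; injection; lra.
    - field. repeat split; try exact H; try exact Ci_nz; injection; lra. }
  split; [exact HX|].
  assert (H1 : X ^ 2 - 1 <> 0).
  { intros E. apply HX. replace (X ^ 2) with (X ^ 2 - 1 + 1) by ring. rewrite E. ring. }
  field.
  cbv beta. split; [|split; [exact H|split; [exact Ci_nz|]]].
  - intros E. apply H1. transitivity (- (1 - X ^ 2)); [ring | rewrite E; ring].
  - intros E. apply H1. transitivity (X * X - 1); [ring | exact E].
Qed.

Lemma Ccot_plus_PI (z : C) : Ccot (z + RtoC PI) = Ccot z.
Proof.
  destruct z as [x y]. unfold Ccot.
  replace ((x, y) + RtoC PI) with ((x + PI)%R, y) by (unfold Cplus, RtoC; simpl; f_equal; ring).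
  rewrite !Csin_pair, !Ccos_pair, neg_sin, neg_cos.
  unfold Cdiv, Cinv, Cmult; simpl.
  f_equal; unfold Rdiv;
  replace (- sin x * cosh y * (- sin x * cosh y * 1) + - cos x * sinh y * (- cos x * sinh y * 1))%R
   with (sin x * cosh y * (sin x * cosh y * 1) + cos x * sinh y * (cos x * sinh y * 1))%R by ring; ring.
Qed.

(** The finite analogue of the partial fraction expansion: [N * cot (N u)] has the
same poles and residues as the sum of the translates of [cot]. *)
Lemma Ccot_mult (n : nat) (u : C) :
  Im u <> 0%R ->
  RtoC (INR (S n)) * Ccot (RtoC (INR (S n)) * u) =
  sum_n (fun j => Ccot (u + RtoC (INR j * (PI / INR (S n))))) n.
Proof.
  intros Hu.
  assert (HN : (0 < INR (S n))%R) by (apply lt_0_INR; lia).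
  set (q := Cexp (Ci * u) ^ 2).
  assert (Hq : q ^ S n = Cexp (Ci * (RtoC (INR (S n)) * u)) ^ 2).
  { unfold q. rewrite <- Cpow_mult_r, Nat.mul_comm, Cpow_mult_r, Cexp_pow.
    f_equal. f_equal. ring. }
  assert (HIm : Im (RtoC (INR (S n)) * u) <> 0%R).
  { destruct u as [x y]; simpl in *. rewrite Rmult_0_l, Rplus_0_r. apply Rmult_integral_contrapositive. split; [apply Rgt_not_eq, HN | exact Hu]. }
  destruct (Ccot_Cexp _ (Csin_neq_0 _ HIm)) as [Hne HN'].
  rewrite <- Hq in Hne, HN'. rewrite HN'.
  assert (Hsum := sum_inv_unity_roots n q 1).
  rewrite !Cpow_1_l in Hsum.
  rewrite (sum_n_ext _ (fun r => Ci + - (2 * Ci) * / (1 - q * unity_root (S n) ^ r))).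
  - rewrite Csum_plus, Csum_const, Csum_mult_l, Hsum by congruence.
    unfold Cdiv. ring.
  - intros j.
    assert (Hj : Im (u + RtoC (INR j * (PI / INR (S n)))) <> 0%R).
    { destruct u as [x y]; simpl in *. now rewrite Rplus_0_r. }
    destruct (Ccot_Cexp _ (Csin_neq_0 _ Hj)) as [_ ->].
    replace (Cexp (Ci * (u + RtoC (INR j * (PI / INR (S n))))) ^ 2)
      with (q * unity_root (S n) ^ j).
    + Cring.
    + unfold q, unity_root. rewrite !Cexp_pow, <- Cexp_plus. f_equal.
      replace (2 * PI / INR (S n))%R with (2 * (PI / INR (S n)))%R by (field; lra).
      rewrite !RtoC_mult. simpl (INR 2). replace (1 + 1)%R with 2%R by ring. ring.
Qed.

(** For odd [N] the nonzero indices [j] and [N - j] pair up. The paired terms decay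
like [1 / j ^ 2], whereas the single cotangents have no summable bound. The value
[N = 2 m + 3] leaves exactly [m + 1 >= 1] pairs, the length of [sum_n _ m]. *)
Lemma Ccot_pairs (m : nat) (u : C) :
  Im u <> 0%R ->
  let N := INR (2 * m + 3) in
  RtoC N * Ccot (RtoC N * u) =
  Ccot u + sum_n (fun i =>
    Csin (2 * u) / (Csin u ^ 2 - RtoC (sin (INR (S i) * (PI / N))) ^ 2)) m.
Proof.
  intros Hu N. unfold N.
  replace (2 * m + 3)%nat with (S (S (2 * m + 1))) by lia.
  rewrite Ccot_mult by exact Hu.
  rewrite Csum_head, sum_fold_pairs. f_equal.
  - f_equal. simpl (INR 0). rewrite Rmult_0_l. ring.
  - apply sum_n_ext_loc. intros i Hi.
    set (v := (INR (S i) * (PI / INR (S (S (2 * m + 1)))))%R).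
    rewrite <- Csin_R.
    rewrite <- Ccot_plus_minus.
    + f_equal. rewrite <- (Ccot_plus_PI (u - v)). f_equal.
      replace (S (2 * m + 1 - i)) with (S (S (2 * m + 1)) - S i)%nat by lia.
      rewrite minus_INR by lia. unfold v.
      assert (INR (S (S (2 * m + 1))) <> 0%R) by (apply not_0_INR; lia).
      replace ((INR (S (S (2 * m + 1))) - INR (S i)) * (PI / INR (S (S (2 * m + 1)))))%R
        with (PI - INR (S i) * (PI / INR (S (S (2 * m + 1)))))%R by now field.
      rewrite RtoC_minus. ring.
    + apply Csin_neq_0. destruct u as [x y]; simpl in *. now rewrite Rplus_0_r.
    + apply Csin_neq_0. destruct u as [x y]; simpl in *. now rewrite Ropp_0, Rplus_0_r.
Qed.

(** * Limits of complex sequences and dominated convergence *)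

(** Convergence is stated on real and imaginary parts so that limits of products,
quotients and dominated sums reduce to the real statements. *)
Definition Clim_seq (u : nat -> C) (l : C) : Prop :=
  is_lim_seq (fun n => Re (u n)) (Re l) /\ is_lim_seq (fun n => Im (u n)) (Im l).

Lemma Clim_seq_ext (u v : nat -> C) (l : C) :
  (forall n, u n = v n) -> Clim_seq u l -> Clim_seq v l.
Proof.
  intros H [H1 H2]. split.
  - apply (is_lim_seq_ext _ _ _ (fun n => f_equal Re (H n)) H1).
  - apply (is_lim_seq_ext _ _ _ (fun n => f_equal Im (H n)) H2).
Qed.

Lemma Clim_seq_const (l : C) : Clim_seq (fun _ => l) l.
Proof. split; apply is_lim_seq_const. Qed.

Lemma Clim_seq_RtoC (u : nat -> R) (l : R) :
  is_lim_seq u l -> Clim_seq (fun n => RtoC (u n)) (RtoC l).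
Proof. intros H. split; [exact H | apply is_lim_seq_const]. Qed.

Lemma Clim_seq_minus (u v : nat -> C) (l l' : C) :
  Clim_seq u l -> Clim_seq v l' -> Clim_seq (fun n => u n - v n) (l - l').
Proof. intros [H1 H2] [H3 H4]. split; now apply is_lim_seq_minus'. Qed.

Lemma Clim_seq_mult (u v : nat -> C) (l l' : C) :
  Clim_seq u l -> Clim_seq v l' -> Clim_seq (fun n => u n * v n) (l * l').
Proof.
  intros [H1 H2] [H3 H4]. split; simpl.
  - apply is_lim_seq_minus'; now apply is_lim_seq_mult'.
  - apply is_lim_seq_plus'; now apply is_lim_seq_mult'.
Qed.

Lemma Clim_seq_inv (u : nat -> C) (l : C) :
  l <> 0 -> Clim_seq u l -> Clim_seq (fun n => / u n) (/ l).
Proof.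
  intros Hl [H1 H2].
  assert (Hd : (Re l ^ 2 + Im l ^ 2 <> 0)%R).
  { intros E. apply Hl. apply Cmod_eq_0.
    assert (H := Cmod2_alt l). rewrite E in H. nra. }
  assert (Hn : is_lim_seq (fun n => Re (u n) ^ 2 + Im (u n) ^ 2)%R (Re l ^ 2 + Im l ^ 2)%R).
  { simpl. apply is_lim_seq_plus'; repeat apply is_lim_seq_mult'; try assumption; apply is_lim_seq_const. }
  split; simpl.
  - now apply is_lim_seq_div'.
  - apply is_lim_seq_div'; try assumption. now apply (is_lim_seq_opp _ (Im l)).
Qed.

Lemma Clim_seq_bounded (u : nat -> C) (l : C) :
  Clim_seq u l -> exists M : R, (0 < M)%R /\ forall n, (Cmod (u n) <= M)%R.
Proof.
  intros [H1 H2].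
  destruct (maj_by_pos _ (exist _ _ (proj1 (is_lim_seq_Reals _ _) H1))) as [M1 [P1 B1]].
  destruct (maj_by_pos _ (exist _ _ (proj1 (is_lim_seq_Reals _ _) H2))) as [M2 [P2 B2]].
  exists (M1 + M2)%R. split; [lra|]. intros n. specialize (B1 n). specialize (B2 n).
  destruct (u n) as [x y]; simpl in *.
  replace (x, y) with (RtoC x + Ci * RtoC y)
    by (unfold RtoC, Ci, Cmult, Cplus; simpl; f_equal; ring).
  eapply Rle_trans; [apply Cmod_triangle|].
  rewrite Cmod_mult, Cmod_Ci, !Cmod_R. lra.
Qed.

Lemma is_series_C (f : nat -> C) (l : C) :
  is_series (K := C_AbsRing) (V := C_NormedModule) f l <-> Clim_seq (sum_n f) l.
Proof.
  split.
  - intros H.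
    assert (Hb := proj1 (filterlim_locally (U := C_UniformSpace) (sum_n f) l) H).
    split; apply is_lim_seq_spec; intros e; destruct (Hb e) as [n0 Hn0]; exists n0; intros n Hn;
    destruct (Hn0 n Hn) as [H1 H2]; [exact H1 | exact H2].
  - intros [H1 H2]. apply (filterlim_locally (U := C_UniformSpace) (sum_n f) l).
    intros e. apply is_lim_seq_spec in H1, H2.
    destruct (H1 e) as [n1 B1], (H2 e) as [n2 B2]. exists (max n1 n2). intros n Hn.
    split; [apply (B1 n) | apply (B2 n)]; lia.
Qed.

Lemma is_series_RtoC (f : nat -> R) (l : R) :
  is_series f l ->
  is_series (K := C_AbsRing) (V := C_NormedModule) (fun n => RtoC (f n)) (RtoC l).
Proof.
  intros H. apply is_series_C.
  apply (Clim_seq_ext _ _ _ (fun n => eq_sym (Csum_RtoC f n))).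
  apply Clim_seq_RtoC, H.
Qed.

Lemma is_series_RtoC_inv (f : nat -> R) (l : C) :
  is_series (K := C_AbsRing) (V := C_NormedModule) (fun n => RtoC (f n)) l ->
  l = RtoC (Series f).
Proof.
  intros H. apply is_series_C in H.
  apply (Clim_seq_ext _ _ _ (Csum_RtoC f)) in H. destruct H as [H1 H2].
  rewrite (is_series_unique f (Re l) H1).
  apply is_lim_seq_unique in H2. simpl in H2. rewrite Lim_seq_const in H2.
  injection H2 as H2. destruct l as [x y]; simpl in *. now rewrite <- H2.
Qed.

Lemma is_series_sum_n (f : nat -> nat -> C) (l : nat -> C) (p : nat) :
  (forall r, (r <= p)%nat -> is_series (K := C_AbsRing) (V := C_NormedModule) (f r) (l r)) ->
  is_series (K := C_AbsRing) (V := C_NormedModule)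
    (fun i => sum_n (fun r => f r i) p) (sum_n l p).
Proof.
  induction p as [|p IH]; intros H.
  - rewrite sum_O. apply (is_series_ext (f 0%nat)); [intros i; now rewrite sum_O | apply H; lia].
  - rewrite Csum_Sn.
    apply (is_series_ext (fun i => plus (sum_n (fun r => f r i) p) (f (S p) i))).
    + intros i. now rewrite sum_Sn.
    + apply (is_series_plus (V := C_NormedModule)); [apply IH; intros r Hr; apply H; lia | apply H; lia].
Qed.

(** Dominated convergence for sums whose length grows with the parameter. Up to
the index [M >= J] the sums converge termwise; beyond it, all of them are
bounded by a tail of [b], uniformly in [m]. *)
Lemma tannery (T : nat -> nat -> R) (t b : nat -> R) (J : nat) (L : R) :
  (forall i, is_lim_seq (fun m => T m i) (t i)) ->
  (forall m i, (J <= i <= m)%nat -> (Rabs (T m i) <= b i)%R) ->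
  ex_series b ->
  is_lim_seq (fun m => sum_n (T m) m) L ->
  is_series t L.
Proof.
  intros Ht Hb Hex HL.
  apply (is_lim_seq_spec (sum_n t) L). intros e.
  destruct (Cauchy_ex_series b Hex (pos_div_2 e)) as [N0 HN0].
  exists (max N0 J). intros M HM.
  apply Rle_lt_trans with (e / 2)%R; [|destruct e; simpl; lra].
  assert (Hlim : is_lim_seq (fun m => Rabs (sum_n (T m) M - sum_n (T m) m)) (Rabs (sum_n t M - L)%R)).
  { apply (is_lim_seq_abs _ (Finite (sum_n t M - L)%R)). apply is_lim_seq_minus'; [|exact HL].
    clear HM. induction M as [|M IH].
    - rewrite sum_O. apply (is_lim_seq_ext (fun m => T m 0%nat)); [|apply Ht].
      intros m. now rewrite sum_O.
    - rewrite sum_Sn. apply (is_lim_seq_ext (fun m => (sum_n (T m) M + T m (S M))%R)).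
      + intros m. now rewrite sum_Sn.
      + apply is_lim_seq_plus'; [exact IH | apply Ht]. }
  refine (is_lim_seq_le_loc _ (fun _ => (e / 2)%R) _ (Finite (e / 2)%R) _ Hlim (is_lim_seq_const _)).
  exists M. intros m Hm.
  rewrite Rabs_minus_sym.
  replace (sum_n (T m) m - sum_n (T m) M)%R with (sum_n_m (T m) (S M) m)
    by exact (sum_n_m_sum_n (T m) M m Hm).
  apply Rle_trans with (sum_n_m b (S M) m).
  - apply Rle_trans with (sum_n_m (fun i => Rabs (T m i)) (S M) m).
    + apply (norm_sum_n_m (T m) (S M) m).
    + rewrite <- (sum_n_m_ext_loc (fun i => Rmin (Rabs (T m i)) (b i))).
      * apply sum_n_m_le. intros i. apply Rmin_r.
      * intros i Hi. apply Rmin_left. apply Hb. lia.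
  - apply Rle_trans with (norm (sum_n_m b (S M) m)); [apply Rle_abs|].
    apply Rlt_le. apply (HN0 (S M) m); lia.
Qed.

Lemma tannery_C (T : nat -> nat -> C) (t : nat -> C) (b : nat -> R) (J : nat) (L : C) :
  (forall i, Clim_seq (fun m => T m i) (t i)) ->
  (forall m i, (J <= i <= m)%nat -> (Cmod (T m i) <= b i)%R) ->
  ex_series b ->
  Clim_seq (fun m => sum_n (T m) m) L ->
  is_series (K := C_AbsRing) (V := C_NormedModule) t L.
Proof.
  intros Ht Hb Hex [HL1 HL2]. apply is_series_C. split.
  - apply (is_lim_seq_ext (sum_n (fun i => Re (t i)))); [intros n; now rewrite Re_Csum|].
    apply (tannery (fun m i => Re (T m i)) _ b J); [intros i; apply Ht| |exact Hex|].
    + intros m i Hi. eapply Rle_trans; [apply re_le_Cmod | now apply Hb].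
    + apply (is_lim_seq_ext _ _ _ (fun m => Re_Csum (T m) m) HL1).
  - apply (is_lim_seq_ext (sum_n (fun i => Im (t i)))); [intros n; now rewrite Im_Csum|].
    apply (tannery (fun m i => Im (T m i)) _ b J); [intros i; apply Ht| |exact Hex|].
    + intros m i Hi. eapply Rle_trans; [|now apply Hb].
      eapply Rle_trans; [apply Rmax_r | apply Rmax_Cmod].
    + apply (is_lim_seq_ext _ _ _ (fun m => Im_Csum (T m) m) HL2).
Qed.

(** * The partial fraction expansion of the cotangent *)

(** The difference quotient of [f] at 0 along the step [x / N n]. *)
Lemma is_lim_seq_rescale (f : R -> R) (d x : R) (N : nat -> R) :
  is_derive f 0%R d -> f 0%R = 0%R -> is_lim_seq N p_infty ->
  is_lim_seq (fun n => N n * f (x / N n))%R (d * x)%R.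
Proof.
  intros Hf Hf0 HN.
  assert (Hinf : forall M : R, eventually (fun n => M < N n)%R)
    by exact (proj2 (is_lim_seq_spec N p_infty) HN).
  destruct (Req_dec x 0) as [->|Hx].
  - apply (is_lim_seq_ext_loc (fun _ => 0%R)).
    + destruct (Hinf 0%R) as [n0 Hn0]. exists n0. intros n Hn. specialize (Hn0 n Hn).
      replace (0 / N n)%R with 0%R by (field; lra). rewrite Hf0. ring.
    + rewrite Rmult_0_r. apply is_lim_seq_const.
  - apply is_lim_seq_spec. intros e. apply is_derive_Reals in Hf.
    assert (He : (0 < e / Rabs x)%R).
    { apply Rdiv_lt_0_compat; [apply e | now apply Rabs_pos_lt]. }
    destruct (Hf _ He) as [delta Hd].
    destruct (Hinf (Rabs x / delta)%R) as [n0 Hn0]. exists n0. intros n Hn. specialize (Hn0 n Hn).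
    assert (Hdx : (0 < Rabs x / delta)%R).
    { apply Rdiv_lt_0_compat; [now apply Rabs_pos_lt | apply delta]. }
    assert (HNn : (0 < N n)%R) by lra.
    assert (Hh : (x / N n)%R <> 0%R).
    { apply Rmult_integral_contrapositive. split; [exact Hx | apply Rinv_neq_0_compat; lra]. }
    assert (Hs : (Rabs (x / N n) < delta)%R).
    { rewrite Rabs_div, (Rabs_pos_eq (N n)) by lra.
      apply Rlt_div_l; [exact HNn|]. apply Rlt_div_l in Hn0; [lra | apply delta]. }
    specialize (Hd _ Hh Hs). rewrite Rplus_0_l, Hf0, Rminus_0_r in Hd.
    replace (N n * f (x / N n) - d * x)%R with ((f (x / N n) / (x / N n) - d) * x)%R by (field; lra).
    rewrite Rabs_mult. apply Rlt_div_r in Hd; [exact Hd | now apply Rabs_pos_lt].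
Qed.

Lemma is_lim_seq_cont (f : R -> R) (x : R) (N : nat -> R) :
  continuous f 0%R -> is_lim_seq N p_infty -> is_lim_seq (fun n => f (x / N n)%R) (f 0%R).
Proof.
  intros Hf HN. apply (filterlim_comp _ _ _ _ _ _ (locally 0%R)); [|exact Hf].
  change (is_lim_seq (fun n => (x / N n)%R) 0%R).
  replace (Finite 0) with (Rbar_mult x 0) by (simpl; now rewrite Rmult_0_r).
  apply is_lim_seq_scal_l. apply (is_lim_seq_inv N p_infty); [exact HN | discriminate].
Qed.

Lemma Csin_rescale (N : nat -> R) (w : C) :
  is_lim_seq N p_infty ->
  Clim_seq (fun n => RtoC (N n) * Csin (RtoC (/ N n) * w)) w.
Proof.
  intros HN. destruct w as [x y].
  assert (Hsin : is_derive sin 0%R 1%R) by (rewrite <- cos_0; apply is_derive_Reals, derivable_pt_lim_sin).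
  assert (Hsinh : is_derive sinh 0%R 1%R) by (rewrite <- cosh_0; apply is_derive_Reals, derivable_pt_lim_sinh).
  assert (Hcos : continuous cos 0%R).
  { apply continuity_pt_filterlim, continuity_cos. }
  assert (Hcosh : continuous cosh 0%R).
  { apply continuity_pt_filterlim, derivable_continuous_pt, derivable_pt_cosh. }
  apply (Clim_seq_ext (fun n => ((N n * sin (x / N n) * cosh (y / N n))%R,
                              (cos (x / N n) * (N n * sinh (y / N n)))%R))).
  - intros n. replace (RtoC (/ N n) * (x, y)) with ((x / N n)%R, (y / N n)%R)
      by (unfold RtoC, Cmult, Rdiv; simpl; f_equal; ring).
    rewrite Csin_pair. unfold RtoC, Cmult; simpl. f_equal; ring.
  - split; simpl.
    + replace (Finite x) with (Finite (1 * x * cosh 0)) by (rewrite cosh_0; f_equal; ring).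
      apply is_lim_seq_mult'; [now apply is_lim_seq_rescale; try apply sin_0 | now apply is_lim_seq_cont].
    + replace (Finite y) with (Finite (cos 0 * (1 * y))) by (rewrite cos_0; f_equal; ring).
      apply is_lim_seq_mult'; [now apply is_lim_seq_cont | now apply is_lim_seq_rescale; try apply sinh_0].
Qed.

Lemma Ccos_rescale (N : nat -> R) (w : C) :
  is_lim_seq N p_infty -> Clim_seq (fun n => Ccos (RtoC (/ N n) * w)) 1.
Proof.
  intros HN. destruct w as [x y].
  assert (Hsin : continuous sin 0%R) by apply continuity_pt_filterlim, continuity_sin.
  assert (Hcos : continuous cos 0%R) by apply continuity_pt_filterlim, continuity_cos.
  assert (Hcosh : continuous cosh 0%R).
  { apply continuity_pt_filterlim, derivable_continuous_pt, derivable_pt_cosh. }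
  assert (Hsinh : continuous sinh 0%R).
  { apply continuity_pt_filterlim, derivable_continuous_pt, derivable_pt_sinh. }
  apply (Clim_seq_ext (fun n => ((cos (x / N n) * cosh (y / N n))%R,
                              (- (sin (x / N n) * sinh (y / N n)))%R))).
  - intros n. replace (RtoC (/ N n) * (x, y)) with ((x / N n)%R, (y / N n)%R)
      by (unfold RtoC, Cmult, Rdiv; simpl; f_equal; ring).
    now rewrite Ccos_pair.
  - split; simpl.
    + replace (Finite 1) with (Finite (cos 0 * cosh 0)) by (rewrite cos_0, cosh_0; f_equal; ring).
      apply is_lim_seq_mult'; now apply is_lim_seq_cont.
    + replace (Finite 0) with (Finite (- (sin 0 * sinh 0))) by (rewrite sin_0; f_equal; ring).
      apply (is_lim_seq_opp _ (Finite (sin 0 * sinh 0))).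
      apply is_lim_seq_mult'; now apply is_lim_seq_cont.
Qed.

(** A cheap form of Jordan's inequality: [sin v >= v - v ^ 3 / 6] and [v <= 2]. *)
Lemma sin_lower_bound (v : R) : (0 <= v <= PI / 2)%R -> (v / 3 <= sin v)%R.
Proof.
  intros Hv. assert (H4 := PI_4).
  destruct (pre_sin_bound v 0) as [H _]; try lra.
  eapply Rle_trans; [|exact H].
  unfold sin_approx, sin_term; simpl.
  assert (v * v * v <= 4 * v)%R by nra. lra.
Qed.

(** The nodes occurring in [Ccot_pairs] stay below [PI / 2], so there the sine is
bounded below by a linear function, uniformly in [m]; the constant 1 comes
from [PI > 3]. *)
Lemma sin_node_lower_bound (m i : nat) :
  (i <= m)%nat ->
  let N := INR (2 * m + 3) in
  (INR (S i) <= N * sin (INR (S i) * (PI / N)))%R.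
Proof.
  intros Hi N.
  assert (HPI := PI_RGT_0). assert (H3 := PI2_3_2).
  assert (HN : (0 < N)%R) by (apply lt_0_INR; lia).
  set (j := INR (S i)).
  assert (Hj : (0 < j)%R) by (apply lt_0_INR; lia).
  assert (HjN : (2 * j < N)%R).
  { unfold j, N. change 2%R with (INR 2). rewrite <- mult_INR. apply lt_INR. lia. }
  assert (Hv : (0 <= j * (PI / N) <= PI / 2)%R).
  { split.
    - apply Rmult_le_pos; [lra | apply Rlt_le, Rdiv_lt_0_compat; lra].
    - replace (j * (PI / N))%R with (2 * j / N * (PI / 2))%R by (field; lra).
      assert (2 * j / N < 1)%R by (apply Rlt_div_l; lra). nra. }
  apply sin_lower_bound in Hv.
  apply Rle_trans with (N * (j * (PI / N) / 3))%R; [|apply Rmult_le_compat_l; lra].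
  replace (N * (j * (PI / N) / 3))%R with (j * (PI / 3))%R by (field; lra).
  nra.
Qed.

(** Comparison with the telescoping series of [1 / j - 1 / (j + 1)]. *)
Lemma ex_series_inv_sq : ex_series (fun i => / INR (S i) ^ 2)%R.
Proof.
  apply (ex_series_le (K := R_AbsRing) (V := R_CompleteNormedModule) _
          (fun i => 2 * (/ INR (S i) - / INR (S (S i))))%R).
  - intros i. change norm with Rabs.
    assert (H : (1 <= INR (S i))%R) by (rewrite S_INR; assert (E := pos_INR i); lra).
    rewrite Rabs_pos_eq by (apply Rlt_le, Rinv_0_lt_compat, pow_lt; lra).
    rewrite (S_INR (S i)). set (x := INR (S i)) in *.
    replace (2 * (/ x - / (x + 1)))%R with (/ (x * (x + 1) / 2))%R by (field; lra).
    apply Rinv_le_contravar; nra.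
  - exists (2 * (1 - 0))%R. change (is_lim_seq (sum_n (fun i => 2 * (/ INR (S i) - / INR (S (S i))))%R) (2 * (1 - 0))%R).
    apply (is_lim_seq_ext (fun n => 2 * (1 - / INR (S (S n))))%R).
    + intros n. induction n as [|n IH].
      * rewrite sum_O. simpl. field.
      * rewrite sum_Sn, <- IH. change plus with Rplus. ring.
    + apply is_lim_seq_mult'; [apply is_lim_seq_const|].
      apply is_lim_seq_minus'; [apply is_lim_seq_const|].
      apply (is_lim_seq_inv _ p_infty); [|discriminate].
      apply (is_lim_seq_le_p_loc INR); [|apply is_lim_seq_INR].
      exists 0%nat. intros n _. apply le_INR. lia.
Qed.

(** Euler's expansion of the cotangent, as the limit [m -> oo] of [Ccot_pairs]
taken at [u = PI z / N] with [N = 2 m + 3]. The domination needed by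
[tannery_C] comes from two bounds: [N sin u] and [N sin (2 u)] converge, hence
are bounded, while [N sin (j PI / N) >= j]. *)
Lemma Ccot_partial_fractions (z : C) :
  Im z <> 0%R ->
  is_series (K := C_AbsRing) (V := C_NormedModule)
    (fun i => 2 * z / (z ^ 2 - RtoC (INR (S i)) ^ 2))
    (RtoC PI * Ccot (RtoC PI * z) - / z).
Proof.
  intros Hz.
  assert (HPI := PI_RGT_0).
  assert (HPI0 : RtoC PI <> 0) by (intros E; apply RtoC_inj in E; lra).
  assert (Hz0 : z <> 0) by (intros E; apply Hz; rewrite E; reflexivity).
  set (N := fun m => INR (2 * m + 3)).
  assert (HNpos : forall m, (0 < N m)%R) by (intros m; apply lt_0_INR; lia).
  assert (HN0 : forall m, RtoC (N m) <> 0).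
  { intros m E. apply RtoC_inj in E. specialize (HNpos m). lra. }
  assert (HN : is_lim_seq N p_infty).
  { apply (is_lim_seq_le_p_loc INR); [|apply is_lim_seq_INR].
    exists 0%nat. intros m _. apply le_INR. lia. }
  set (u := fun m => RtoC (/ N m) * (RtoC PI * z)).
  assert (Hu : forall m, Im (u m) <> 0%R).
  { intros m. unfold u. destruct z as [x y]; simpl in *.
    specialize (HNpos m).
    replace (/ N m * (PI * y + 0 * x) + 0 * (PI * x - 0 * y))%R with (PI * y / N m)%R by (field; lra).
    apply Rmult_integral_contrapositive. split; [apply Rmult_integral_contrapositive; lra|].
    apply Rinv_neq_0_compat; lra. }
  set (v := fun m i => (INR (S i) * (PI / N m))%R).
  set (T := fun m i => RtoC (PI / N m) *
     (Csin (2 * u m) / (Csin (u m) ^ 2 - RtoC (sin (v m i)) ^ 2))).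
  (* N absorbed into each sine: numerator and denominator now both converge. *)
  assert (HT : forall m i, T m i = RtoC PI * (RtoC (N m) * Csin (RtoC (/ N m) * (2 * (RtoC PI * z))))
     / ((RtoC (N m) * Csin (u m)) * (RtoC (N m) * Csin (u m))
        - RtoC (N m * sin (v m i)) * RtoC (N m * sin (v m i)))).
  { intros m i. unfold T.
    assert (Hd : Csin (u m) ^ 2 - RtoC (sin (v m i)) ^ 2 <> 0).
    { rewrite <- Csin_R, <- Csin_mult_plus_minus.
      apply Cmult_neq_0; apply Csin_neq_0; specialize (Hu m);
      destruct (u m) as [x y]; simpl in *; [now rewrite Rplus_0_r | now rewrite Ropp_0, Rplus_0_r]. }
    replace (RtoC (/ N m) * (2 * (RtoC PI * z))) with (2 * u m) by (unfold u; ring).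
    rewrite RtoC_div by (specialize (HNpos m); lra). rewrite RtoC_mult.
    set (D := Csin (u m) ^ 2 - RtoC (sin (v m i)) ^ 2) in *.
    replace (RtoC (N m) * Csin (u m) * (RtoC (N m) * Csin (u m)) -
       RtoC (N m) * RtoC (sin (v m i)) * (RtoC (N m) * RtoC (sin (v m i)))) with
       (RtoC (N m) * RtoC (N m) * D) by (unfold D; ring).
    field. split; [exact Hd | apply HN0]. }
  assert (LS2 : Clim_seq (fun m => RtoC (N m) * Csin (RtoC (/ N m) * (2 * (RtoC PI * z)))) (2 * (RtoC PI * z)))
    by now apply Csin_rescale.
  assert (LS1 : Clim_seq (fun m => RtoC (N m) * Csin (u m)) (RtoC PI * z))
    by now apply Csin_rescale.
  assert (LV : forall i, Clim_seq (fun m => RtoC (N m * sin (v m i))) (RtoC (INR (S i) * PI))).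
  { intros i. apply Clim_seq_RtoC.
    replace (INR (S i) * PI)%R with (1 * (INR (S i) * PI))%R by ring.
    apply (is_lim_seq_ext (fun m => N m * sin (INR (S i) * PI / N m))%R).
    - intros m. unfold v, Rdiv. now rewrite Rmult_assoc.
    - apply is_lim_seq_rescale; [|apply sin_0|exact HN].
      rewrite <- cos_0. apply is_derive_Reals, derivable_pt_lim_sin. }
  destruct (Clim_seq_bounded _ _ LS1) as [C1 [C1pos HC1]].
  destruct (Clim_seq_bounded _ _ LS2) as [C2 [C2pos HC2]].
  destruct (INR_unbounded (2 * C1)) as [J HJ].
  apply (tannery_C T _ (fun i => 2 * PI * C2 * / INR (S i) ^ 2)%R J).
  - intros i.
    assert (Hd : z ^ 2 - RtoC (INR (S i)) ^ 2 <> 0).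
    { replace (z ^ 2 - RtoC (INR (S i)) ^ 2) with ((z + RtoC (INR (S i))) * (z - RtoC (INR (S i)))) by ring.
      apply Cmult_neq_0; intros E; apply Hz; apply (f_equal Im) in E;
      destruct z as [x y]; simpl in E, Hz; simpl; lra. }
    assert (Hfac : (RtoC PI * z) * (RtoC PI * z) - RtoC (INR (S i) * PI) * RtoC (INR (S i) * PI)
      = RtoC PI * RtoC PI * (z ^ 2 - RtoC (INR (S i)) ^ 2)) by (rewrite RtoC_mult; ring).
    apply (Clim_seq_ext _ _ _ (fun m => eq_sym (HT m i))).
    replace (2 * z / (z ^ 2 - RtoC (INR (S i)) ^ 2)) with
      (RtoC PI * (2 * (RtoC PI * z)) / ((RtoC PI * z) * (RtoC PI * z)
        - RtoC (INR (S i) * PI) * RtoC (INR (S i) * PI))).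
    + apply Clim_seq_mult; [apply Clim_seq_mult; [apply Clim_seq_const | exact LS2]|].
      apply Clim_seq_inv.
      * rewrite Hfac. repeat apply Cmult_neq_0; assumption.
      * apply Clim_seq_minus; apply Clim_seq_mult; auto.
    + rewrite Hfac. field. now split.
  (* For j = i + 1 > 2 C1 the denominator has modulus at least
     j^2 - C1^2 >= j^2 / 2. *)
  - intros m i Hi. rewrite HT.
    specialize (HC1 m). specialize (HC2 m). specialize (HNpos m).
    set (j := INR (S i)) in *.
    assert (Hj : (INR J < j)%R) by (apply lt_INR; lia).
    assert (HV : (j <= N m * sin (v m i))%R) by (apply sin_node_lower_bound; lia).
    set (V := (N m * sin (v m i))%R) in *.
    set (A := RtoC (N m) * Csin (u m)) in *.
    set (B := RtoC (N m) * Csin (RtoC (/ N m) * (2 * (RtoC PI * z)))) in *.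
    assert (HD : (j ^ 2 / 2 <= Cmod (A * A - RtoC V * RtoC V))%R).
    { assert (H := Cmod_triangle (A * A) (- (A * A - RtoC V * RtoC V))).
      replace (A * A + - (A * A - RtoC V * RtoC V)) with (RtoC V * RtoC V) in H by ring.
      rewrite Cmod_opp, !Cmod_mult, Cmod_R, Rabs_pos_eq in H by lra.
      assert (Cmod A * Cmod A <= C1 * C1)%R by (assert (E := Cmod_ge_0 A); nra).
      nra. }
    assert (Hj2 : (0 < j ^ 2)%R) by (apply pow_lt; lra).
    unfold Cdiv. rewrite !Cmod_mult, Cmod_inv, Cmod_R, Rabs_pos_eq; try lra.
    + apply Rle_trans with (PI * C2 * / (j ^ 2 / 2))%R.
      * apply Rmult_le_compat.
        -- apply Rmult_le_pos; [lra | apply Cmod_ge_0].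
        -- apply Rlt_le, Rinv_0_lt_compat. lra.
        -- apply Rmult_le_compat_l; lra.
        -- apply Rinv_le_contravar; lra.
      * right. field. lra.
    + intros E. rewrite E, Cmod_0 in HD. lra.
  - exact (ex_series_scal_l (V := R_NormedModule) (2 * PI * C2)%R _ ex_series_inv_sq).
  - apply (Clim_seq_ext (fun m => RtoC PI * Ccot (RtoC PI * z) -
       RtoC PI * Ccos (u m) * / (RtoC (N m) * Csin (u m)))).
    + intros m.
      assert (H := Ccot_pairs m (u m) (Hu m)). cbv zeta in H.
      fold (N m) in H.
      replace (RtoC (N m) * u m) with (RtoC PI * z) in H
        by (unfold u; rewrite RtoC_inv by (specialize (HNpos m); lra); field; apply HN0).
      unfold T. rewrite Csum_mult_l. unfold v.
      replace (sum_n (fun i => Csin (2 * u m) / (Csin (u m) ^ 2 - RtoC (sin (INR (S i) * (PI / N m))) ^ 2)) m)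
        with (RtoC (N m) * Ccot (RtoC PI * z) - Ccot (u m)) by (rewrite H; ring).
      rewrite RtoC_div by (specialize (HNpos m); lra). unfold Ccot at 3.
      field. split; [apply Csin_neq_0, Hu | apply HN0].
    + apply Clim_seq_minus; [apply Clim_seq_const|].
      replace (/ z) with (RtoC PI * 1 * / (RtoC PI * z)) by (field; now split).
      apply Clim_seq_mult; [apply Clim_seq_mult; [apply Clim_seq_const | now apply Ccos_rescale]|].
      apply Clim_seq_inv; [now apply Cmult_neq_0 | exact LS1].
Qed.

(** * The cotangent averages as real series *)

Lemma eps_Cexp (k r : nat) :
  (0 < k)%nat -> eps k r = Cexp (Ci * RtoC (PI * ((INR r + 1 / 2) / INR k))).
Proof.
  intros Hk. assert (INR k <> 0%R) by (apply not_0_INR; lia).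
  assert (RtoC (INR k) <> 0) by (intros E; now apply RtoC_inj in E).
  assert (RtoC 2 <> 0) by (intros E; apply RtoC_inj in E; lra).
  unfold eps. f_equal. rewrite RtoC_mult, RtoC_div, RtoC_plus, RtoC_div by lra.
  field. assumption.
Qed.

(** The squares of the [eps k r] are the k-th roots of -1, a translate of the k-th
roots of unity. *)
Lemma eps_sqr (k r : nat) :
  (0 < k)%nat -> eps k r ^ 2 = Cexp (Ci * RtoC (PI / INR k)) * unity_root k ^ r.
Proof.
  intros Hk. assert (INR k <> 0%R) by (apply not_0_INR; lia).
  rewrite eps_Cexp by exact Hk. unfold unity_root.
  rewrite !Cexp_pow, <- Cexp_plus. f_equal.
  transitivity (Ci * RtoC (PI / INR k + INR r * (2 * PI / INR k))).
  - replace (PI / INR k + INR r * (2 * PI / INR k))%R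
      with (2 * (PI * ((INR r + 1 / 2) / INR k)))%R by (field; lra).
    rewrite (RtoC_mult 2). simpl (INR 2). replace (1 + 1)%R with 2%R by ring. ring.
  - rewrite RtoC_plus, (RtoC_mult (INR r)). ring.
Qed.

(** The argument of [eps k r] lies strictly between 0 and [PI]: the points at which
[a] evaluates the cotangent are never real. *)
Lemma Im_eps_pos (k r : nat) : (r < k)%nat -> (0 < Im (eps k r))%R.
Proof.
  intros Hr. rewrite eps_Cexp, Cexp_Im by lia. simpl.
  assert (HPI := PI_RGT_0).
  assert (0 <= INR r)%R by apply pos_INR.
  assert (INR r + 1 <= INR k)%R by (rewrite <- S_INR; apply le_INR; lia).
  assert (0 < (INR r + 1 / 2) / INR k)%R by (apply Rdiv_lt_0_compat; lra).
  assert ((INR r + 1 / 2) / INR k < 1)%R by (apply Rlt_div_l; lra).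
  apply sin_gt_0; nra.
Qed.

(** With [t = (eps * w) ^ 2] and [y = j ^ 2], each summand is [2 t / (w (t - y)) =
2 / w - 2 y / (w (y - t))], and the [t] are the k-th roots of [- w ^ (2 k)]. *)
Lemma average_over_eps (p : nat) (w j : R) :
  (0 < w)%R -> (0 < j)%R ->
  / RtoC (INR (S p)) *
    sum_n (fun r => eps (S p) r * (2 * (eps (S p) r * RtoC w)
                     / ((eps (S p) r * RtoC w) ^ 2 - RtoC j ^ 2))) p
  = RtoC (2 * w ^ (2 * p + 1) / (w ^ (2 * S p) + j ^ (2 * S p))).
Proof.
  intros Hw Hj.
  assert (HK : RtoC (INR (S p)) <> 0).
  { intros E. apply RtoC_inj in E. now apply not_0_INR in E. }
  assert (Hw0 : RtoC w <> 0) by (intros E; apply RtoC_inj in E; lra).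
  set (q := RtoC w ^ 2 * Cexp (Ci * RtoC (PI / INR (S p)))).
  set (y := RtoC j ^ 2).
  assert (Hq : q ^ S p = - RtoC (w ^ (2 * S p))).
  { unfold q. rewrite Cpow_mult_l, <- Cpow_mult_r, Cexp_pow, <- RtoC_pow.
    replace (RtoC (INR (S p)) * (Ci * RtoC (PI / INR (S p)))) with (Ci * RtoC PI).
    - rewrite Cexp_Im, cos_PI, sin_PI. replace ((-1)%R, 0%R) with (RtoC (-1)) by reflexivity.
      rewrite <- RtoC_mult, <- RtoC_opp. f_equal. ring.
    - rewrite RtoC_div by now apply not_0_INR. field. exact HK. }
  assert (Hy : y ^ S p = RtoC (j ^ (2 * S p))).
  { unfold y. now rewrite <- Cpow_mult_r, <- RtoC_pow. }
  assert (Hwj : (0 < w ^ (2 * S p) + j ^ (2 * S p))%R).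
  { assert (E1 := pow_lt w (2 * S p) Hw). assert (E2 := pow_lt j (2 * S p) Hj). lra. }
  assert (Hne : y ^ S p <> q ^ S p).
  { rewrite Hq, Hy, <- RtoC_opp. intros E. apply RtoC_inj in E. lra. }
  rewrite (sum_n_ext _ (fun r => 2 / RtoC w + - (2 * y / RtoC w) * / (y - q * unity_root (S p) ^ r))).
  - rewrite Csum_plus, Csum_const, Csum_mult_l, sum_inv_unity_roots by exact Hne.
    replace (- (2 * y / RtoC w) * (RtoC (INR (S p)) * y ^ p / (y ^ S p - q ^ S p)))
      with (- (2 / RtoC w * RtoC (INR (S p)) * (y ^ S p / (y ^ S p - q ^ S p)))).
    + rewrite Hq, Hy.
      replace (w ^ (2 * S p))%R with (w * w ^ (2 * p + 1))%R in *
        by (replace (2 * S p)%nat with (S (2 * p + 1)) by lia; reflexivity).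
      set (W := (w ^ (2 * p + 1))%R) in *. set (J := (j ^ (2 * S p))%R) in *.
      assert (HD : RtoC w * RtoC W + RtoC J <> 0).
      { rewrite <- RtoC_mult, <- RtoC_plus. intros E. apply RtoC_inj in E. lra. }
      rewrite RtoC_div, RtoC_plus, !RtoC_mult by lra.
      field. repeat split; try assumption.
    + rewrite (Cpow_S y p) at 1. unfold Cdiv. ring.
  - intros r.
    assert (Ht : (eps (S p) r * RtoC w) ^ 2 = q * unity_root (S p) ^ r).
    { rewrite Cpow_mult_l, eps_sqr by lia. unfold q. ring. }
    fold y. rewrite Ht.
    set (t := q * unity_root (S p) ^ r) in *.
    assert (Hyt : y - t <> 0).
    { intros E. apply Hne. transitivity (t ^ S p).
      - f_equal. replace y with (y - t + t) by ring. rewrite E. ring.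
      - unfold t. rewrite Cpow_mult_l, <- Cpow_mult_r, Nat.mul_comm, Cpow_mult_r, unity_root_pow, Cpow_1_l by lia. ring. }
    transitivity (2 / RtoC w * ((eps (S p) r * RtoC w) ^ 2 / (t - y))).
    + assert (t - y <> 0) by (intros E; apply Hyt; transitivity (- (t - y)); [ring | rewrite E; ring]).
      Cfield. now split.
    + rewrite Ht.
      assert (t - y <> 0) by (intros E; apply Hyt; transitivity (- (t - y)); [ring | rewrite E; ring]).
      Cfield. repeat split; assumption.
Qed.

Lemma a_partial_fractions (k : nat) (w : R) :
  (1 <= k)%nat -> (0 < w)%R ->
  is_series (K := C_AbsRing) (V := C_NormedModule)
    (fun i => RtoC (2 * w ^ (2 * k - 1) / (w ^ (2 * k) + INR (S i) ^ (2 * k))))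
    (a k w - RtoC (/ w)).
Proof.
  intros Hk Hw. destruct k as [|p]; [lia|].
  assert (HK : RtoC (INR (S p)) <> 0).
  { intros E. apply RtoC_inj in E. now apply not_0_INR in E. }
  assert (Hw0 : RtoC w <> 0) by (intros E; apply RtoC_inj in E; lra).
  assert (He : forall r, (r <= p)%nat -> eps (S p) r <> 0 /\ Im (eps (S p) r * RtoC w) <> 0%R).
  { intros r Hr. assert (H := Im_eps_pos (S p) r). split.
    - intros E. rewrite E in H. simpl in H. specialize (H ltac:(lia)). lra.
    - destruct (eps (S p) r) as [x y]; simpl in *. specialize (H ltac:(lia)).
      apply Rgt_not_eq. nra. }
  replace (a (S p) w - RtoC (/ w)) with (/ RtoC (INR (S p)) *
    sum_n (fun r => eps (S p) r * (RtoC PI * Ccot (RtoC PI * (eps (S p) r * RtoC w))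
                                   - / (eps (S p) r * RtoC w))) p).
  - apply (is_series_ext (fun i => / RtoC (INR (S p)) * sum_n (fun r => eps (S p) r *
       (2 * (eps (S p) r * RtoC w) / ((eps (S p) r * RtoC w) ^ 2 - RtoC (INR (S i)) ^ 2))) p)).
    + intros i. rewrite average_over_eps by (try exact Hw; apply lt_0_INR; lia).
      now replace (2 * S p - 1)%nat with (2 * p + 1)%nat by lia.
    + apply (is_series_scal (K := C_AbsRing) (V := C_NormedModule) (/ RtoC (INR (S p)))).
      apply (is_series_sum_n (fun r i => eps (S p) r *
       (2 * (eps (S p) r * RtoC w) / ((eps (S p) r * RtoC w) ^ 2 - RtoC (INR (S i)) ^ 2)))).
      intros r Hr.
      apply (is_series_scal (K := C_AbsRing) (V := C_NormedModule) (eps (S p) r)).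
      apply Ccot_partial_fractions. now apply He.
  - unfold a. replace (S p - 1)%nat with p by lia.
    rewrite (sum_n_ext_loc _ (fun r => RtoC PI * eps (S p) r * Ccot (RtoC PI * eps (S p) r * RtoC w)
         + - / RtoC w)).
    + rewrite Csum_plus, Csum_const, RtoC_inv by lra. field. now split.
    + intros r Hr. destruct (He r Hr) as [He0 _]. rewrite Cmult_assoc. Cfield. now split.
Qed.

Lemma a_eq_Series (k : nat) (w : R) :
  (1 <= k)%nat -> (0 < w)%R ->
  a k w = RtoC (/ w + Series (fun i =>
    2 * w ^ (2 * k - 1) / (w ^ (2 * k) + INR (S i) ^ (2 * k)))%R).
Proof.
  intros Hk Hw. rewrite RtoC_plus.
  rewrite <- (is_series_RtoC_inv _ _ (a_partial_fractions k w Hk Hw)). ring.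
Qed.

(** * Symmetrization of the double series *)

Lemma Rsum_mult_l (c : R) (f : nat -> R) (n : nat) :
  sum_n (fun i => c * f i)%R n = (c * sum_n f n)%R.
Proof. exact (sum_n_mult_l (K := R_Ring) c f n). Qed.

Lemma sum_n_nonneg_incr (f : nat -> R) (n m : nat) :
  (forall i, 0 <= f i)%R -> (n <= m)%nat -> (sum_n f n <= sum_n f m)%R.
Proof.
  intros Hf. induction 1 as [|m Hm IH]; [lra|].
  rewrite sum_Sn. change plus with Rplus. specialize (Hf (S m)). lra.
Qed.

Lemma sum_n_le_series (f : nat -> R) (l : R) (n : nat) :
  (forall i, 0 <= f i)%R -> is_series f l -> (sum_n f n <= l)%R.
Proof.
  intros Hf Hl. apply (is_lim_seq_incr_compare (sum_n f) l Hl).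
  intros m. apply sum_n_nonneg_incr; [exact Hf | lia].
Qed.

Lemma sum_n_le (f g : nat -> R) (n : nat) :
  (forall i, f i <= g i)%R -> (sum_n f n <= sum_n g n)%R.
Proof. intros H. now apply sum_n_m_le. Qed.

(** Since [2 / (x (x + y)) + 2 / (y (y + x)) = 2 / (x y)], the sum of
[2 / (A n * (A n + A i))] over a square [n, i <= N] equals the square of the
partial sum of [/ A n]. All terms being nonnegative, the iterated partial sums
are squeezed between these squares and [Z ^ 2]. *)
Lemma is_series_symmetrized (A : nat -> R) (Z : R) :
  (forall n, 0 < A n)%R -> is_series (fun n => / A n)%R Z ->
  is_series (fun n => Series (fun i => 2 / (A n * (A n + A i))))%R (Z ^ 2)%R.
Proof.
  intros HA HZ.
  set (g := fun n i => (2 / (A n * (A n + A i)))%R).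
  assert (Hg : forall n i, (0 <= g n i)%R).
  { intros n i. assert (H1 := HA n). assert (H2 := HA i).
    apply Rlt_le, Rdiv_lt_0_compat; [lra|]. apply Rmult_lt_0_compat; lra. }
  assert (Hex : forall n, ex_series (g n)).
  { intros n. apply (ex_series_le (K := R_AbsRing) (V := R_CompleteNormedModule) _ (fun i => 2 / A n * / A i)%R).
    - intros i. assert (H1 := HA n). assert (H2 := HA i).
      change norm with Rabs. rewrite Rabs_pos_eq by apply Hg. unfold g.
      replace (2 / (A n * (A n + A i)))%R with (2 / A n * / (A n + A i))%R by (field; lra).
      apply Rmult_le_compat_l; [apply Rlt_le, Rdiv_lt_0_compat; lra|].
      apply Rinv_le_contravar; lra.
    - apply (ex_series_scal_l (V := R_NormedModule) (2 / A n)%R). now exists Z. }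
  assert (Hsq : forall N, sum_n (fun n => sum_n (g n) N) N = (sum_n (fun n => / A n)%R N ^ 2)%R).
  { intros N.
    assert (H : (sum_n (fun n => sum_n (g n) N) N + sum_n (fun n => sum_n (g n) N) N
                 = 2 * sum_n (fun n => / A n)%R N ^ 2)%R).
    { rewrite (sum_n_switch g) at 2.
      change (plus (sum_n (fun n => sum_n (g n) N) N) (sum_n (fun j => sum_n (fun i => g i j) N) N)
              = 2 * sum_n (fun n => / A n)%R N ^ 2)%R.
      rewrite <- sum_n_plus.
      transitivity (sum_n (fun n => 2 * sum_n (fun i => / A i) N * / A n)%R N).
      - apply sum_n_ext. intros n. rewrite <- sum_n_plus.
        transitivity (sum_n (fun i => 2 * / A n * / A i)%R N).
        + apply sum_n_ext. intros i. unfold g. change plus with Rplus.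
          assert (H1 := HA n). assert (H2 := HA i). Rfield. lra.
        + rewrite Rsum_mult_l. Rring.
      - rewrite Rsum_mult_l. Rring. }
    lra. }
  assert (HAi : forall i, (0 <= / A i)%R) by (intros i; apply Rlt_le, Rinv_0_lt_compat, HA).
  change (is_lim_seq (sum_n (fun n => Series (g n))) (Z ^ 2)%R).
  apply (is_lim_seq_le_le (fun N => (sum_n (fun n => / A n)%R N ^ 2)%R) _ (fun _ => (Z ^ 2)%R)).
  - intros N. split.
    + rewrite <- Hsq. apply sum_n_le. intros n.
      apply sum_n_le_series; [apply Hg | apply Series_correct, Hex].
    + assert (Hl : is_lim_seq (fun M => sum_n (fun n => sum_n (g n) M) N) (sum_n (fun n => Series (g n)) N)).
      { induction N as [|N IH].
        - rewrite sum_O. apply (is_lim_seq_ext (sum_n (g 0%nat))); [intros M; now rewrite sum_O|].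
          apply Series_correct, Hex.
        - rewrite sum_Sn.
          apply (is_lim_seq_ext (fun M => sum_n (fun n => sum_n (g n) M) N + sum_n (g (S N)) M)%R);
            [intros M; now rewrite sum_Sn|].
          apply is_lim_seq_plus'; [exact IH | apply Series_correct, Hex]. }
      refine (is_lim_seq_le_loc _ (fun _ => (Z ^ 2)%R) _ (Finite (Z ^ 2)%R) _ Hl (is_lim_seq_const _)).
      exists N. intros M HM.
      apply Rle_trans with (sum_n (fun n => sum_n (g n) M) M).
      * apply sum_n_nonneg_incr; [|exact HM]. intros n.
        apply Rle_trans with (sum_n (g n) 0); [rewrite sum_O; apply Hg|].
        apply sum_n_nonneg_incr; [apply Hg | lia].
      * rewrite Hsq.
        assert (H1 := sum_n_le_series _ _ M HAi HZ).
        assert (H0 : (0 <= sum_n (fun n => / A n)%R M)%R).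
        { apply Rle_trans with (sum_n (fun n => / A n)%R 0); [rewrite sum_O; apply HAi|].
          apply sum_n_nonneg_incr; [apply HAi | lia]. }
        now apply pow_incr.
  - simpl. apply is_lim_seq_mult'; [exact HZ|]. apply is_lim_seq_mult'; [exact HZ | apply is_lim_seq_const].
  - apply is_lim_seq_const.
Qed.

(** * Zeta values and the identity *)

Lemma zeta_INR (m : nat) : zeta (RtoC (INR m)) = RtoC (Series (fun n => / INR (S n) ^ m)%R).
Proof.
  assert (H : forall n, Cexp (- (RtoC (INR m) * RtoC (ln (INR (S n))))) = RtoC (/ INR (S n) ^ m)).
  { intros n. assert (Hn : (0 < INR (S n))%R) by (apply lt_0_INR; lia).
    rewrite <- RtoC_mult, <- RtoC_opp. unfold RtoC at 1. rewrite Cexp_pair, cos_0, sin_0, exp_Ropp.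
    change (exp (INR m * ln (INR (S n)))) with (Rpower (INR (S n)) (INR m)).
    rewrite Rpower_pow by exact Hn. unfold RtoC. f_equal; ring. }
  unfold zeta, CSeries.
  change (RtoC (Series (fun n => / INR (S n) ^ m)%R)) with (Series (fun n => / INR (S n) ^ m)%R, 0%R).
  f_equal.
  - apply Series_ext. intros n. now rewrite H.
  - transitivity (Series (fun _ => 0 * 0)%R).
    + apply Series_ext. intros n. rewrite H. simpl. ring.
    + rewrite Series_scal_l. ring.
Qed.

Lemma ex_series_inv_pow (m : nat) : (2 <= m)%nat -> ex_series (fun n => / INR (S n) ^ m)%R.
Proof.
  intros Hm.
  apply (ex_series_le (K := R_AbsRing) (V := R_CompleteNormedModule) _ (fun n => / INR (S n) ^ 2)%R); [|apply ex_series_inv_sq].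
  intros n. change norm with Rabs.
  assert (H : (1 <= INR (S n))%R) by (rewrite S_INR; assert (E := pos_INR n); lra).
  rewrite Rabs_pos_eq by (apply Rlt_le, Rinv_0_lt_compat, pow_lt; lra).
  apply Rinv_le_contravar; [apply pow_lt; lra | now apply Rle_pow].
Qed.

Theorem theorem1 (k : nat) (hk : (1 <= k)%nat) :
  is_series (K := C_AbsRing) (V := C_NormedModule)
    (fun n : nat => a k (INR (S n)) / RtoC (INR (S n)) ^ (4 * k - 1))
    (zeta (RtoC (INR (2 * k))) ^ 2 + zeta (RtoC (INR (4 * k)))).
Proof.
  set (A := fun n => (INR (S n) ^ (2 * k))%R).
  assert (HA : forall n, (0 < A n)%R) by (intros n; apply pow_lt, lt_0_INR; lia).
  assert (H2 := Series_correct _ (ex_series_inv_pow (2 * k) ltac:(lia))).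
  assert (H4 := Series_correct _ (ex_series_inv_pow (4 * k) ltac:(lia))).
  rewrite !zeta_INR, <- RtoC_pow, <- RtoC_plus.
  apply (is_series_ext (fun n => RtoC
    (Series (fun i => 2 / (A n * (A n + A i))) + / INR (S n) ^ (4 * k))%R)).
  - intros n.
    rewrite a_eq_Series by (try exact hk; apply lt_0_INR; lia).
    set (w := INR (S n)). assert (Hw : (0 < w)%R) by (apply lt_0_INR; lia).
    assert (Hwp : (0 < w ^ (4 * k - 1))%R) by now apply pow_lt.
    assert (Hs : Series (fun i => 2 * w ^ (2 * k - 1) / (w ^ (2 * k) + INR (S i) ^ (2 * k)))%R
      = (w ^ (4 * k - 1) * Series (fun i => 2 / (A n * (A n + A i))))%R).
    { rewrite <- Series_scal_l. apply Series_ext. intros i.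
      assert (H5 := HA n). assert (H6 := HA i). unfold A in *. fold w in H5 |- *.
      replace (4 * k - 1)%nat with (2 * k - 1 + 2 * k)%nat by lia. rewrite pow_add.
      field. lra. }
    rewrite Hs, <- RtoC_pow, <- RtoC_div by lra.
    replace (w ^ (4 * k))%R with (w * w ^ (4 * k - 1))%R
      by (replace (4 * k)%nat with (S (4 * k - 1)) at 2 by lia; reflexivity).
    f_equal. field. lra.
  - apply is_series_RtoC, (is_series_plus (V := R_NormedModule)); [|exact H4].
    now apply is_series_symmetrized.
Qed.
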